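(* There exists a bounded sequence $\mathbf w=(w_n)_{n\in\mathbb Z}$ of positive real numbers such that the bilateral weighted shift $B_{\mathbf w}$ on $c_0(\mathbb Z)$, defined by $B_{\mathbf w}(e_n)=w_ne_{n-1}$ for $n\in\mathbb Z$, is frequently hypercyclic but not distributionally chaotic.
   Context: $(e_n)_{n\in\mathbb Z}$ is the standard basis of $c_0(\mathbb Z)$ (families indexed by $\mathbb Z$ tending to $0$ at $\pm\infty$, sup norm). For $A\subset\mathbb Z_+=\{0,1,2,\dots\}$, the lower density is $\underline d(A)=\liminf_{n\to+\infty}\frac{\#\{a\in A: a\le n\}}{n}$. A bounded operator $T$ on a Banach space $X$ is frequently hypercyclic if there is $x\in X$ such that for every nonempty open $U\subset X$ the set $\{n\in\mathbb Z_+: T^nx\in U\}$ has positive lower density. Distributional chaos: let $f:X\to X$ be a continuous map on a metric space $(X,d)$. For $x,y\in X$, $n\in\mathbb N$ (positive), $\tau>0$ put $F^n_{xy}(\tau)=\frac1n\#\{0\le i\le n-1: d(f^i(x),f^i(y))<\tau\}$, $F_{xy}(\tau)=\liminf_{n\to+\infty}F^n_{xy}(\tau)$ and $F^*_{xy}(\tau)=\limsup_{n\to+\infty}F^n_{xy}(\tau)$. The map $f$ is distributionally chaotic if there exist an uncountable set $\Gamma\subset X$ and $\varepsilon>0$ such that for every $\tau>0$ and every pair of distinct points $x,y\in\Gamma$ one has $F_{xy}(\varepsilon)=0$ and $F^*_{xy}(\tau)=1$. (For an operator, $d$ is the norm distance.) *)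

(* Defs.v *)
From HB Require Import structures.
From mathcomp Require Import all_boot all_order all_algebra.
From mathcomp Require Import all_classical all_reals all_analysis.
From mathcomp Require Import complex.
Set Implicit Arguments.
Unset Strict Implicit.
Unset Printing Implicit Defensive.
Import Order.TTheory GRing.Theory Num.Theory.
Import numFieldNormedType.Exports.
Local Open Scope classical_set_scope.
Local Open Scope ring_scope.

(* The scalar field K is a parameter, meant to be R or R[i]. In a numFieldType
   norms take their values in K itself and 0 < tau forces tau to be real, so
   that in the complex case the distances and the thresholds are real numbers
   seen in K. *)

Section c0.
Context {K : numFieldType}.

Definition c0_set (x : int -> K^o) : Prop :=
  (fun k : nat => x k%:Z) @ \oo --> (0 : K^o) /\
  (fun k : nat => x (- k%:Z)) @ \oo --> (0 : K^o).

Definition c0_pred : {pred (int -> K^o)} := fun x => `[< c0_set x >].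

Lemma c0_predP x : reflect (c0_set x) (x \in c0_pred).
Proof. exact: asboolP. Qed.

Lemma c0_submod_closed : submod_closed c0_pred.
Proof.
split; first by apply/c0_predP; split; exact: cvg_cst.
move=> a x y /c0_predP[xp xm] /c0_predP[yp ym]; apply/c0_predP; split.
- have := cvgD (cvgZl_tmp (k := a) xp) yp; rewrite scaler0 addr0; exact.
- have := cvgD (cvgZl_tmp (k := a) xm) ym; rewrite scaler0 addr0; exact.
Qed.

HB.instance Definition _ :=
  GRing.isSubmodClosed.Build K (int -> K^o) c0_pred c0_submod_closed.

End c0.

Record c0 (K : numFieldType) := C0 {
  c0_fun :> int -> K^o;
  c0P : c0_fun \in c0_pred
}.


HB.instance Definition _ (K : numFieldType) := [isSub for @c0_fun K].
HB.instance Definition _ (K : numFieldType) := [Choice of c0 K by <:].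
HB.instance Definition _ (K : numFieldType) :=
  [SubChoice_isSubLmodule of c0 K by <:].

Section c0_norm.
Context {K : numFieldType}.
Implicit Types x y : c0 K.

Lemma c0_ext x y : (forall n, x n = y n) -> x = y.
Proof. by move=> xy; apply/val_inj/funext. Qed.

Lemma c0_small x (e : K) : 0 < e ->
  exists N : nat, forall n : int, (N <= `|n|)%N -> `|x n| < e.
Proof.
move=> e0; have /c0_predP[xp xm] := c0P x.
have /cvgr0Pnorm_lt/(_ e e0)[P _ HP] := xp.
have /cvgr0Pnorm_lt/(_ e e0)[M _ HM] := xm.
exists (maxn P M) => n; rewrite geq_max => /andP[Pn Mn].
have [n0|n0] := leP 0 n.
  by have := HP `|n|%N Pn; rewrite /= gez0_abs.
by have := HM `|n|%N Mn; rewrite /= ltz0_abs// opprK.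
Qed.

Let seq_max x k s :
  exists n, forall m, m \in k :: s -> `|x m| <= `|x n|.
Proof.
elim: s k => [k|a s IH k]; first by exists k => m; rewrite inE => /eqP->.
have [n nmax] := IH a.
have /orP[kn|nk] := real_leVge (normr_real (x k)) (normr_real (x n)).
  by exists n => m; rewrite inE => /predU1P[->//|]; exact: nmax.
exists k => m; rewrite inE => /predU1P[->//|/nmax]/le_trans; exact.
Qed.

Lemma c0_max x : exists n, forall m, `|x m| <= `|x n|.
Proof.
have [[k xk]|x0] := pselect (exists k, x k != 0); last first.
  by exists 0 => m; have [->|xm] := eqVneq (x m) 0; rewrite ?normr0//; case: x0; exists m.
have xk0 : 0 < `|x k| by rewrite normr_gt0.
have [N xN] := c0_small x xk0.
have [n nmax] := seq_max x k
  ([seq i%:Z | i <- iota 0 N] ++ [seq - i%:Z | i <- iota 0 N]).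
exists n => m; have [mN|Nm] := ltnP `|m| N; last first.
  by rewrite (le_trans (ltW (xN _ Nm)))// nmax// mem_head.
apply: nmax; rewrite inE mem_cat; apply/orP; right; apply/orP.
have [m0|m0] := leP 0 m; [left|right]; apply/mapP; exists `|m|%N;
  rewrite ?mem_iota//.
  by rewrite gez0_abs.
by rewrite ltz0_abs// opprK.
Qed.

Definition c0_norm x : K := supremum 0 (range (fun n => `|x n|)).

Lemma c0_normE x n : (forall m, `|x m| <= `|x n|) -> c0_norm x = `|x n|.
Proof.
move=> xn; have supn : supremums (range (fun n => `|x n|)) `|x n|.
  by split=> [_ [m _ <-]//|b]; apply; exists n.
rewrite /c0_norm /supremum ifF; last first.
  by apply/eqP => /seteqP[/(_ `|x n|)+ _]; apply; exists n.
by case: xgetP => [b _ bsup|/(_ _ supn)//]; exact: is_subset1_supremums bsup supn.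
Qed.

Lemma c0_norm_ub x n : `|x n| <= c0_norm x.
Proof. by have [k xk] := c0_max x; rewrite (c0_normE xk). Qed.

Lemma c0_norm_le x (M : K) : (forall n, `|x n| <= M) -> c0_norm x <= M.
Proof. by have [k xk] := c0_max x; rewrite (c0_normE xk). Qed.

Let ler_c0_normD x y : c0_norm (x + y) <= c0_norm x + c0_norm y.
Proof.
apply: c0_norm_le => n; rewrite (le_trans (ler_normD _ _))//.
by rewrite lerD// c0_norm_ub.
Qed.

Let c0_normZ (a : K) x : c0_norm (a *: x) = `|a| * c0_norm x.
Proof.
have [k xk] := c0_max x; rewrite (c0_normE xk) -normrM.
have axE m : (a *: x) m = a * x m by [].
by rewrite -axE; apply: c0_normE => m; rewrite !axE !normrM ler_wpM2l.
Qed.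

Let c0_norm_eq0 x : c0_norm x = 0 -> x = 0.
Proof.
move=> x0; apply: c0_ext => n; apply/eqP.
by rewrite -normr_le0 -x0 c0_norm_ub.
Qed.

HB.instance Definition _ :=
  Lmodule_isNormed.Build K (c0 K) ler_c0_normD c0_normZ c0_norm_eq0.

Let c0_dist x y : K := `|x - y|.

Let c0_dist_ge0 x y : 0 <= c0_dist x y. Proof. exact: normr_ge0. Qed.

Let c0_dist_eq0 x y : c0_dist x y = 0 -> x = y.
Proof. by move=> /normr0_eq0/eqP; rewrite subr_eq0 => /eqP. Qed.

Let c0_ballE x (d : K) : ball x d = [set y | c0_dist x y < d].
Proof. by rewrite -ball_normE. Qed.

HB.instance Definition _ :=
  PseudoMetric_isMetric.Build K (c0 K) c0_dist_ge0 c0_dist_eq0 c0_ballE.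

Lemma c0_basis_subproof (n : int) :
  (fun m => (m == n)%:R) \in @c0_pred K.
Proof.
apply/c0_predP; split; apply/cvgr0Pnorm_lt => e e0;
  (exists `|n|.+1 => // k /= nk; rewrite (_ : _ == _ = false) ?normr0//);
  apply/eqP => kn; move: nk; by rewrite -kn ?abszN absz_nat ltnn.
Qed.

Definition c0_basis (n : int) : c0 K := C0 (c0_basis_subproof n).

End c0_norm.

(* The frequencies below are 0 at n = 0 (division by zero), which does not
   affect the limits. *)
Section dynamics.
Context (R : realType).

Definition lower_density (A : set nat) : \bar R :=
  limn_einf (fun n => (#|[pred a : 'I_n.+1 | val a \in A]|%:R / n%:R)%:E).

Definition frequently_hypercyclic (X : topologicalType) (T : X -> X) :=
  exists x : X, forall U : set X, open U -> U !=set0 ->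
    (0 < lower_density [set n | U (iter n T x)])%E.

Section chaos.
Context (K : numFieldType) (X : metricType K) (f : X -> X).

Definition close_freq (x y : X) (tau : K) (n : nat) : \bar R :=
  (#|[pred i : 'I_n | mdist (iter i f x) (iter i f y) < tau]|%:R / n%:R)%:E.

Definition distributionally_chaotic :=
  exists (Gamma : set X) (eps : K), [/\ ~ countable Gamma, 0 < eps &
    forall tau : K, 0 < tau -> forall x y, Gamma x -> Gamma y -> x <> y ->
      limn_einf (close_freq x y eps) = 0%E /\
      limn_esup (close_freq x y tau) = 1%E].
End chaos.
End dynamics.

(* The span of the basis being dense in c0, these conditions determine B. *)
Definition is_weighted_shift (K : numFieldType) (w : int -> K)
    (B : {linear c0 K -> c0 K}) :=
  continuous B /\ forall n, B (c0_basis n) = w n *: c0_basis (n - 1).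

(* Main.v *)
(* Let D, E_0, E_1, ... be sets of naturals of positive lower density, with
   0 in D, and let h(j) be the distance from the integer j to -D. For the
   weights w_j = 2^(h(j) - h(j-1)), at most 2 because h is 1-Lipschitz,
   (B^m x)_j = 2^(h(j+m) - h(j)) x_(j+m). Since h vanishes on -D, the norm of
   B^i z is bounded below by a positive constant for i in D, as soon as z <> 0;
   hence B is not distributionally chaotic. On the other hand, if the
   differences m - n with m in E_p and n in E_q stay far (in terms of p and q)
   from D, unless m = n and p = q, then h is large around all the n - m. Given a
   dense sequence (y_p) of finitely supported vectors, writing in x a rescaled
   copy of y_p around every n in E_p produces a vector with B^m x close to y_p
   for every m in E_p, so that B is frequently hypercyclic.
   Such sets exist: E_p consists of the multiples of a large b_p in the
   intervals [16^u, 2 * 16^u), for u in some arithmetic progression attached to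
   p. The differences then are either multiples of b_p or close to the
   intervals [14 * 16^(u-1), 2 * 16^u], and D can be taken in the union of the
   intervals (3 * 16^u, 12 * 16^u), away from the positive multiples of all the
   b_p, which is a small set if b_p grows fast. *)
Require Import Defs.
From HB Require Import structures.
From mathcomp Require Import all_boot all_order all_algebra.
From mathcomp Require Import all_classical all_reals all_analysis.
From mathcomp Require Import complex.
From mathcomp Require Import zify lra.
Import Order.TTheory GRing.Theory Num.Theory.
Import numFieldNormedType.Exports.
Set Implicit Arguments.
Unset Strict Implicit.
Unset Printing Implicit Defensive.
Local Open Scope classical_set_scope.
Local Open Scope ring_scope.

(** * Counting elements, and positive lower density in the naturals *)

Section counting.
Local Open Scope nat_scope.

Definition cnt (A : set nat) (N : nat) : nat := \sum_(i < N) (val i \in A).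

Definition positive_density (A : set nat) : Prop :=
  exists k N0, forall N, N0 <= N -> N <= k * cnt A N.

Lemma card_cnt (A : set nat) N : #|[pred a : 'I_N | val a \in A]| = cnt A N.
Proof.
rewrite /cnt -sum1_card big_mkcond /=; apply: eq_bigr => i _.
by rewrite inE /=; case: (_ \in _).
Qed.

Lemma cnt_leq (A : set nat) m n : m <= n -> cnt A m <= cnt A n.
Proof.
move=> /subnKC <-; rewrite /cnt big_split_ord /=; exact: leq_addr.
Qed.

Lemma cnt_ge_inj (A : set nat) (f : nat -> nat) M N :
  (forall i, i < M -> A (f i) /\ f i < N) ->
  (forall i j, f i = f j -> i = j) -> M <= cnt A N.
Proof.
move=> fA finj; rewrite -card_cnt.
pose g (i : 'I_M) : 'I_N := Ordinal (fA i (ltn_ord i)).2.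
have ginj : injective g by move=> i j /(congr1 val) /= /finj /val_inj.
rewrite -[X in X <= _](card_ord M) -(card_codom ginj).
apply/subset_leq_card/fintype.subsetP => _ /codomP[i ->].
by rewrite unfold_in /=; apply/mem_set/(fA i (ltn_ord i)).1.
Qed.

Lemma sum_near_le m L N :
  \sum_(n < N) ((n <= m + L) && (m <= n + L)) <= 2 * L + 1.
Proof.
rewrite -(big_mkord xpredT (fun n => ((n <= m + L) && (m <= n + L)) : nat)) /=.
rewrite -big_mkcondr /= -big_filter sum1_size /index_iota subn0.
rewrite -[X in _ <= X](size_iota (m - L)); apply: uniq_leq_size.
  by rewrite filter_uniq ?iota_uniq.
by move=> n; rewrite mem_filter !mem_iota; lia.
Qed.

Lemma sum_divn_expn2 M P : \sum_(p < P) M %/ 2 ^ p <= 2 * M.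
Proof.
elim: P M => [|P IH] M; first by rewrite big_ord0.
rewrite big_ord_recl expn0 divn1.
rewrite (eq_bigr (fun p : 'I_P => (M %/ 2) %/ 2 ^ p)); last first.
  by move=> i _; rewrite /= -divnMA expnS.
apply: (@leq_trans (M + 2 * (M %/ 2))); first by rewrite leq_add2l IH.
by lia.
Qed.

(** Scales [c * 16 ^ u'] with [u'] of bounded gaps suffice: from one to the next, the count loses at
    most a constant factor. *)
Lemma positive_density_scale (A : set nat) c r k u0 : 0 < c ->
  (forall u, u0 <= u -> exists u', [/\ u <= u', u' <= u + r &
     16 ^ u' <= k * cnt A (c * 16 ^ u')]) ->
  positive_density A.
Proof.
move=> c0 H; exists (c * 16 ^ r.+1 * k), (c * 16 ^ (u0 + r)) => N leN.
have NC : 0 < N %/ c.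
  by rewrite divn_gt0// (leq_trans _ leN)// leq_pmulr// expn_gt0.
have /andP[t1 t2] := trunc_log_bounds (isT : 1 < 16) NC.
set t := trunc_log 16 _ in t1 t2.
have tN : c * 16 ^ t <= N by rewrite mulnC -leq_divRL.
have Nt : N < c * 16 ^ t.+1 by rewrite mulnC -ltn_divLR.
have ut : u0 + r <= t.
  by apply: trunc_log_max => //; rewrite leq_divRL// mulnC.
have [|u' [u1 u2 u3]] := H (t - r); first by lia.
have tr : t = (t - r) + r by lia.
have le1 : 16 ^ (t - r) <= 16 ^ u' by rewrite leq_exp2l.
have le2 : cnt A (c * 16 ^ u') <= cnt A N.
  by apply: cnt_leq; rewrite (leq_trans _ tN)// leq_mul2l leq_exp2l//; lia.
have {}Nt : N <= c * 16 ^ r.+1 * 16 ^ (t - r).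
  rewrite (leq_trans (ltnW Nt))// -mulnA -expnD leq_mul2l leq_exp2l//; lia.
apply: leq_trans Nt _; rewrite -[X in _ <= X]mulnA leq_mul2l; apply/orP; right.
by rewrite (leq_trans le1)// (leq_trans u3)// leq_mul2l le2 orbT.
Qed.

(** * Separated sets of positive density *)

Section separated_sets.
Variable C : nat -> nat.

Let e p := p + 2 + 8 * C p.
Let b p := 16 ^ e p.

(** In the union bound for [sepD], [8 * C p + 1] absorbs the width of a neighbourhood of a multiple
    of [b p], and [16 * 2 ^ p] makes the sum over [p] a small geometric one. *)
Let b_ge p : 16 * 2 ^ p * (8 * C p + 1) <= b p.
Proof.
rewrite /b /e expnD (expnD 16 p 2).
have h1 : 2 ^ p <= 16 ^ p by case: (p) => // q; rewrite leq_exp2r.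
have h2 : 8 * C p < 16 ^ (8 * C p) by exact: ltn_expl.
nia.
Qed.

(* Distances from multiples of b_p only count for positive multiples: 0 must
   belong to the set, and near 0 every point is close to 0 * b_p for p large. *)
Definition sepD : set nat := [set d | d = 0 \/ exists u,
  3 * 16 ^ u < d < 12 * 16 ^ u /\ forall p k, 0 < k ->
    d + 4 * C p < k * b p \/ k * b p + 4 * C p < d].

(* The 2-adic valuation of u + 1 allots the exponents u to the indices p, each p
   being served along an arithmetic progression. *)
Definition sepE p : set nat := [set n | exists u,
  [/\ 16 ^ u <= n < 2 * 16 ^ u, logn 2 u.+1 = p, b p %| n &
      32 * C p <= 16 ^ u]].

Lemma sepE_density p : positive_density (sepE p).
Proof.
apply: (@positive_density_scale _ 2 (2 * 2 ^ p.+1) (b p)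
  (maxn (e p) (32 * C p))) => // u; rewrite geq_max => /andP[ue uC].
(* [u'.+1] is [2 ^ p] times an odd number, hence of valuation [p], chosen just above [u]. *)
pose m := (u %/ 2 ^ p.+1).+1; pose u' := (2 ^ p * (2 * m).+1).-1.
have p2 : 0 < 2 ^ p by rewrite expn_gt0.
have u'E : u'.+1 = 2 ^ p * (2 * m).+1 by rewrite prednK // muln_gt0 p2.
have lu : logn 2 u'.+1 = p.
  rewrite u'E lognM // pfactorK // logn_coprime ?addn0 // prime_coprime //.
  by rewrite dvdn2; lia.
have := divn_eq u (2 ^ p.+1); have := ltn_pmod u (_ : 0 < 2 ^ p.+1).
rewrite expn_gt0 => /(_ isT).
rewrite -[u %/ _]/(m.-1) expnS => mlt ueq.
have m0 : 0 < m by [].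
have u1 : u <= u' by nia.
have u2 : u' <= u + 2 * (2 * 2 ^ p) by nia.
exists u'; split => //.
have eu : e p <= u' by exact: leq_trans ue u1.
have uE : 16 ^ u' = 16 ^ (u' - e p) * b p by rewrite -expnD subnK.
have b0 : 0 < b p by rewrite expn_gt0.
rewrite [X in X <= _]uE mulnC leq_mul2l; apply/orP; right.
apply: (@cnt_ge_inj _ (fun i => (16 ^ (u' - e p) + i) * b p)) => [i ilt|i j].
  have lt2 : (16 ^ (u' - e p) + i) * b p < 2 * 16 ^ u'.
    by rewrite uE mulnA ltn_mul2r b0 mul2n -addnn ltn_add2l.
  split => //; exists u'; split; rewrite ?dvdn_mull //.
    by rewrite lt2 uE leq_mul2r leq_addr orbT.
  rewrite (leq_trans uC) // (leq_trans u1) //; exact/ltnW/ltn_expl.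
by move/eqP; rewrite eqn_mul2r (gtn_eqF b0) eqn_add2l => /eqP.
Qed.

Let near (n p k : nat) : bool :=
  (n <= k.+1 * b p + 4 * C p) && (k.+1 * b p <= n + 4 * C p).

(** Union bound: of the [9 * M - 1] integers strictly between [3 * M] and [12 * M], at most [3 * M]
    are close to a positive multiple of some [b p]. *)
Lemma sepD_density : positive_density sepD.
Proof.
apply: (@positive_density_scale _ 12 0 1 0) => // u _; exists u.
split; rewrite ?addn0 // mul1n; set M := 16 ^ u.
have M0 : 0 < M by rewrite expn_gt0.
(* As [b p] is large compared with [p] and [C p], only indices [p < 12 * M] and multiples up to
   [24 * M] can come close to [n]. *)
have cover (n : 'I_(12 * M)) : ((3 * M < n < 12 * M) : nat) <=
    (val n \in sepD) + \sum_(p < 12 * M) \sum_(k < (24 * M) %/ b p) near n p k.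
  case: (boolP (3 * M < n < 12 * M)) => // nM.
  have [//|nD] := boolP (val n \in sepD); rewrite add0n.
  have [p [k [k0 [nk1 nk2]]]] : exists p k, [/\ 0 < k,
      k * b p <= n + 4 * C p & n <= k * b p + 4 * C p].
    apply: contrapT => H; move/negP: nD; apply; apply/mem_set; right.
    exists u; split => // p k k0.
    have [|h1] := ltnP (n + 4 * C p) (k * b p); first by left.
    have [|h2] := ltnP (k * b p + 4 * C p) n; first by right.
    by case: H; exists p, k.
  have bp := b_ge p.
  have p2 : p < 2 ^ p by exact: ltn_expl.
  have pM : p < 12 * M by nia.
  have b0 : 0 < b p by rewrite expn_gt0.
  have kM : k.-1 < (24 * M) %/ b p.
    by rewrite prednK // leq_divRL //; nia.
  rewrite (bigD1 (Ordinal pM)) //= (bigD1 (Ordinal kM)) //=.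
  by rewrite /near prednK // nk1 nk2.
have lower : 9 * M - 1 <= \sum_(n < 12 * M) (3 * M < n < 12 * M).
  have := @cnt_ge_inj [set n | 3 * M < n < 12 * M] (fun i => 3 * M + 1 + i)
    (9 * M - 1) (12 * M).
  rewrite -card_cnt -sum1_card big_mkcond /= => h.
  apply: leq_trans (h _ _) _ => [i|i j|]; [|lia|].
    by rewrite /=; split; lia.
  apply: leq_sum => i _; rewrite unfold_in /=.
  by case: ifP => // /set_mem /= ->.
have upper : \sum_(n < 12 * M) \sum_(p < 12 * M) \sum_(k < (24 * M) %/ b p)
    near n p k <= 2 * (24 * M %/ 16).
  rewrite exchange_big /=.
  apply: leq_trans (sum_divn_expn2 _ (12 * M)).
  apply: leq_sum => p _; rewrite exchange_big /=.
  apply: (@leq_trans (\sum_(k < (24 * M) %/ b p) (2 * (4 * C p) + 1))).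
    by apply: leq_sum => k _; exact: sum_near_le.
  rewrite sum_nat_const card_ord -divnMA leq_divRL ?muln_gt0 ?expn_gt0//.
  have := leq_trunc_div (24 * M) (b p); have := b_ge p.
  by nia.
have := leq_trans lower (leq_sum _ (fun n _ => cover n)).
rewrite big_split /= => /leq_trans/(_ (leq_add (leqnn _) upper)).
by rewrite -/(cnt sepD _); lia.
Qed.

Lemma sepE_ge p n : sepE p n -> 4 * C p <= n.
Proof. by move=> [u [/andP[]]]; lia. Qed.

(** Compare the scales [u] of [m] and [v] of [n]. If [u < v], [n] alone is far beyond [m]. If
    [v < u], [m - n] falls between the blocks of [sepD] at scales below [u] and those from [u] on.
    If [u = v], the valuations give [p = q] and [m - n] is a multiple of [b p]: [sepD] avoids it if
    it is positive, and it is far below 0 if it is negative. *)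
Lemma sepE_sep p q n m d : sepE q n -> sepE p m -> sepD d ->
  (q = p /\ n = m) \/
  (2 * (C p + C q) + m < n + d) || (2 * (C p + C q) + n + d < m).
Proof.
move=> [v [/andP[n1 n2] vq bn Cn]] [u [/andP[m1 m2] up bm Cm]] Dd.
have pow k l : k < l -> 16 * 16 ^ k <= 16 ^ l by rewrite -expnS leq_exp2l.
have [uv|vu|uv] := ltngtP u v.
- by right; have := pow _ _ uv; lia.
- right; have := pow _ _ vu => uv16.
  case: Dd => [->|[t [/andP[d1 d2] _]]]; first by lia.
  have [tu|ut] := ltnP t u; first by have := pow _ _ tu; lia.
  have : 16 ^ u <= 16 ^ t by rewrite leq_exp2l.
  by lia.
- subst v; have pq : q = p by rewrite -up -vq.
  rewrite pq in bn Cn *; have [->|nm] := eqVneq n m; [by left|right].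
  have bp : 4 * C p < b p.
    have := b_ge p; have : 0 < 2 ^ p by rewrite expn_gt0.
    by nia.
  have [mn|mn] := leqP m n.
    have /dvdnP[k kE] : b p %| n - m by rewrite dvdn_sub.
    have k0 : 0 < k by rewrite lt0n; apply/eqP => k0; move: kE; rewrite k0; lia.
    by nia.
  have /dvdnP[k kE] : b p %| m - n by rewrite dvdn_sub.
  have k0 : 0 < k by rewrite lt0n; apply/eqP => k0; move: kE; rewrite k0; lia.
  case: Dd => [->|[t [_ /(_ p k k0)]]]; first by nia.
  by lia.
Qed.

End separated_sets.
End counting.

(** * From counting bounds to lower and upper limits *)

Section limits.
Context (R : realType).
Implicit Types (u : (\bar R)^nat) (c : \bar R).

Lemma limn_einf_ge u c N0 : (forall n, (N0 <= n)%N -> c <= u n)%E ->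
  (c <= limn_einf u)%E.
Proof.
move=> cu; rewrite limn_einf_lim; apply: lime_ge; first exact: is_cvg_einfs.
exists N0 => // n /= N0n; apply: le_ereal_inf_tmp => _ [p /= np <-].
by apply: cu; exact: leq_trans np.
Qed.

Lemma limn_esup_le u c N0 : (forall n, (N0 <= n)%N -> u n <= c)%E ->
  (limn_esup u <= c)%E.
Proof.
move=> uc; rewrite limn_esup_lim; apply: lime_le; first exact: is_cvg_esups.
exists N0 => // n /= N0n; apply: ge_ereal_sup => _ [p /= np <-].
by apply: uc; exact: leq_trans np.
Qed.

Lemma lower_density_gt0 (A B : set nat) : positive_density A -> A `<=` B ->
  (0 < lower_density R B)%E.
Proof.
move=> [k [N0 kA]] AB.
apply: (@lt_le_trans _ _ (k.+1%:R^-1)%:E); first by rewrite lte_fin invr_gt0.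
apply: (@limn_einf_ge _ _ (maxn N0 1)) => n; rewrite geq_max => /andP[N0n n0].
rewrite lee_fin ler_pdivlMr ?ltr0n// mulrC ler_pdivrMr ?ltr0n//.
rewrite -natrM ler_nat.
have le1 := kA n.+1 (leqW N0n).
have le2 : (cnt A n.+1 <= #|[pred a : 'I_n.+1 | val a \in B]|)%N.
  rewrite -card_cnt; apply/subset_leq_card/fintype.subsetP => i.
  by rewrite !unfold_in => /set_mem/AB/mem_set.
by nia.
Qed.

(** No time in [A] counts as close, so the frequency is eventually at most [1 - 1 / k.+1]. *)
Lemma close_freq_lt1 (K : numFieldType) (X : metricType K) (f : X -> X)
    (x y : X) (tau : K) (A : set nat) : positive_density A ->
  (forall i, A i -> tau <= mdist (iter i f x) (iter i f y)) ->
  (limn_esup (close_freq R f x y tau) < 1)%E.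
Proof.
move=> [k [N0 kA]] Af.
apply: (@le_lt_trans _ _ (1 - k.+1%:R^-1)%:E); last first.
  by rewrite lte_fin ltrBlDr ltrDl invr_gt0.
apply: (@limn_esup_le _ _ (maxn N0 1)) => n; rewrite geq_max => /andP[N0n n0].
rewrite lee_fin ler_pdivrMr ?ltr0n// mulrBl mul1r lerBrDr mulrC.
have disj : (#|[pred i : 'I_n | (mdist (iter i f x) (iter i f y) < tau)%R]| +
    cnt A n <= n)%N.
  rewrite -card_cnt -[X in (_ <= X)%N]card_ord -cardUI.
  rewrite [X in (_ + X)%N]eq_card0 ?addn0 ?max_card// => i.
  rewrite !inE; apply/andP => -[+ /set_mem/Af].
  by move=> /lt_le_trans /[apply]; rewrite ltxx.
have kA' : n%:R / k.+1%:R <= (cnt A n)%:R :> R.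
  rewrite ler_pdivrMr ?ltr0n// -natrM ler_nat mulnC.
  by rewrite (leq_trans (kA _ N0n))// leq_mul2r leqnSn orbT.
by rewrite (le_trans (lerD (lexx _) kA'))// -natrD ler_nat.
Qed.

End limits.

(** * Weighted shifts with bounded weights *)

Section weighted_shift.
Context (K : numFieldType).
Implicit Types x y : c0 K.

Lemma c0_predI (x : int -> K^o) :
  (forall e, 0 < e -> exists N : nat, forall n, (N <= `|n|)%N -> `|x n| < e) ->
  x \in c0_pred.
Proof.
move=> xs; apply/c0_predP; split; apply/cvgr0Pnorm_lt => e /xs[N xN];
  exists N => // n /= Nn; apply: xN; lia.
Qed.

Section bounded.
Variables (w : int -> K) (M : K).
Hypothesis wM : forall n, `|w n| <= M.

Let M_ge0 : 0 <= M.
Proof. exact: le_trans (wM 0). Qed.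

Lemma wshift_c0 x : (fun j => w (j + 1) * x (j + 1)) \in @c0_pred K.
Proof.
apply: c0_predI => e e0.
have M1 : 0 < M + 1 by rewrite ltr_wpDl.
have [N xN] := c0_small x (divr_gt0 e0 M1).
exists N.+1 => n Nn; rewrite normrM.
apply: (@le_lt_trans _ _ (M * `|x (n + 1)|)).
  by rewrite ler_wpM2r.
apply: (@le_lt_trans _ _ ((M + 1) * `|x (n + 1)|)).
  by rewrite ler_wpM2r// lerDl.
by rewrite -ltr_pdivlMl// mulrC; apply: xN; lia.
Qed.

Definition wshift x : c0 K := C0 (wshift_c0 x).

Lemma wshift_linear : linear wshift.
Proof.
move=> a x y; apply: c0_ext => j /=.
rewrite -[LHS]/(w (j + 1) * (a * x (j + 1) + y (j + 1))).
by rewrite mulrDr mulrCA.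
Qed.

HB.instance Definition _ :=
  GRing.isLinear.Build K (c0 K) (c0 K) _ wshift wshift_linear.

Lemma norm_wshift x : `|wshift x| <= M * `|x|.
Proof.
apply: c0_norm_le => n /=; rewrite normrM.
by apply: ler_pM => //; exact: c0_norm_ub.
Qed.

Lemma wshift_continuous : continuous wshift.
Proof.
move=> x A /nbhs_normP[e /= e0 eA].
have M1 : 0 < M + 1 by rewrite ltr_wpDl.
apply/nbhs_normP; exists (e / (M + 1)) => [|t xt]; first exact: divr_gt0.
apply: eA; rewrite /= in xt *.
rewrite -linearB (le_lt_trans (norm_wshift _))//.
apply: (@le_lt_trans _ _ ((M + 1) * `|x - t|)).
  by rewrite ler_wpM2r// lerDl.
by rewrite -ltr_pdivlMl// mulrC.
Qed.

Lemma wshift_is_weighted_shift : is_weighted_shift w wshift.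
Proof.
split; first exact: wshift_continuous.
move=> n; apply: c0_ext => j.
rewrite -[LHS]/(w (j + 1) * (j + 1 == n)%:R).
rewrite -[RHS]/(w n * (j == n - 1)%:R) -subr_eq opprK.
by case: eqP => [<-//|]; rewrite !mulr0.
Qed.

End bounded.
End weighted_shift.

(** * Distance to the opposite of a set of naturals *)

Section distance.
Variables (D : set nat) (D0 : D 0%N).

Let dist_ex (j : int) :
  exists k, `[< exists2 d, D d & (`|(j + d%:Z)%R| <= k)%N >].
Proof. by exists `|j|%N; apply/asboolP; exists 0%N; rewrite ?addr0. Qed.

Definition distN (j : int) : nat := ex_minn (dist_ex j).

Lemma distN_le j d : D d -> (distN j <= `|(j + d%:Z)%R|)%N.
Proof.
move=> Dd; rewrite /distN; case: ex_minnP => k _; apply.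
by apply/asboolP; exists d.
Qed.

Lemma distN_ge j a :
  (forall d, D d -> (a <= `|(j + d%:Z)%R|)%N) -> (a <= distN j)%N.
Proof.
move=> aD; rewrite /distN; case: ex_minnP => k /asboolP[d Dd jk] _.
exact: leq_trans (aD _ Dd) jk.
Qed.

Lemma distN_lip j i : (distN (j + i) <= distN j + `|i|)%N.
Proof.
rewrite /(distN j); case: ex_minnP => k /asboolP[d Dd jk] _.
by apply: leq_trans (distN_le _ Dd) _; lia.
Qed.

Lemma distN_opp d : D d -> distN (- d%:Z) = 0%N.
Proof. by move=> /(distN_le (- d%:Z)); rewrite addNr; lia. Qed.

End distance.

Lemma ler_exp2z (K : numFieldType) (m n : int) : m <= n -> 2 ^ m <= 2 ^ n :> K.
Proof.
move=> mn; rewrite -[n](subrK m) addrC expfzDr ?pnatr_eq0//.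
rewrite ler_peMr ?exprz_ge0//.
have -> : n - m = `|(n - m)%R|%N by rewrite gez0_abs// subr_ge0.
by rewrite -exprnP exprn_ege1// ler1n.
Qed.

(** * Dynamics of the shift attached to [D] *)

Section example.
Context (R : realType) (K : numFieldType).
Variables (D : set nat) (D0 : D 0%N).

Let h (j : int) : int := (distN D0 j)%:Z.

Definition exweight (j : int) : K := 2 ^ (h j - h (j - 1)).

Lemma exweight_gt0 j : 0 < exweight j.
Proof. exact: exprz_gt0. Qed.

Lemma exweight_le j : `|exweight j| <= 2.
Proof.
rewrite gtr0_norm ?exweight_gt0// /exweight -[X in _ <= X]expr1z ler_exp2z//.
by have := distN_lip D0 (j - 1) 1; rewrite subrK /h; lia.
Qed.

Let T := wshift exweight_le.

(** The exponents telescope: multiplication by [2 ^ h j] formally conjugates the shift to the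
    unweighted one. *)
Lemma iter_exshift m (x : c0 K) j :
  iter m T x j = 2 ^ (h (j + m%:Z) - h j) * x (j + m%:Z).
Proof.
elim: m j => [|m IH] j; first by rewrite addr0 subrr expr0z mul1r.
rewrite iterS -[LHS]/(exweight (j + 1) * iter m T x (j + 1)) IH mulrA.
rewrite /exweight -expfzDr ?pnatr_eq0// addrK.
have -> : j + 1 + m%:Z = j + m.+1%:Z by lia.
by congr (2 ^ _ * _); lia.
Qed.

Lemma exshift_not_chaotic : positive_density D ->
  ~ distributionally_chaotic R T.
Proof.
move=> Dpos [G [eps [ncG _ GP]]].
have [x [y [Gx Gy xy]]] : exists x y, [/\ G x, G y & x <> y].
  apply: contrapT => H; apply: ncG.
  have [[x Gx]|G0] := pselect (G !=set0); last first.
    by rewrite (_ : G = set0); [exact: countable0|exact/nonemptyPn].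
  apply: (@sub_countable _ _ _ [set x]); last exact: countable1.
  apply: subset_card_le => y Gy /=; apply: contrapT => yx.
  by apply: H; exists y, x.
have [k zk] : exists k, (x - y) k != 0.
  apply: contrapT => H; apply: xy; apply/eqP; rewrite -subr_eq0; apply/eqP.
  by apply: c0_ext => k; apply: contrapT => /eqP zk; apply: H; exists k.
(* Coordinate [k - i] of the [i]-th image of [x - y] carries the factor [2 ^ (h k - h (k - i))], and
   [h (k - i) <= |k|] because [h] vanishes at [- i] for [i] in [D]. *)
pose tau : K := 2 ^ (- `|k|%:Z) * `|(x - y) k|.
have tau0 : 0 < tau by rewrite mulr_gt0 ?exprz_gt0// normr_gt0.
have [_ lim1] := GP _ tau0 x y Gx Gy xy.
suff : (limn_esup (close_freq R T x y tau) < 1)%E by rewrite lim1 ltxx.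
apply: (@close_freq_lt1 R K (c0 K) T x y tau D Dpos) => i Di.
have -> : mdist (iter i T x) (iter i T y) = `|iter i T (x - y)|.
  rewrite -[LHS]/(`|iter i T x - iter i T y|); congr `|_|.
  by elim: {Di} i => //= i <-; rewrite /T linearB.
apply: le_trans (c0_norm_ub _ (k - i%:Z)).
rewrite iter_exshift subrK normrM ler_wpM2r// gtr0_norm ?exprz_gt0//.
rewrite ler_exp2z//.
have : (distN D0 (k - i%:Z) <= `|k|)%N.
  by rewrite addrC -[X in (_ <= X)%N]add0n -(distN_opp D0 Di) distN_lip.
by rewrite /h; move: (distN D0 (k - i%:Z)) (distN D0 k) => a b; lia.
Qed.

(** Around [n] in [E p], [x] is [Y p] divided by the factors that the [n]-th iterate applies, so
    that this iterate restores [Y p]. At time [m] in [E p], a window of another [n] in [E q]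
    contributes at most [2 ^ (C q - h j)] at [j], and separation gives [h j >= C p + C q]. *)
Lemma exshift_orbit (Y : nat -> c0 K) (C : nat -> nat) (E : nat -> set nat) :
  (forall e : K, 0 < e -> exists a : nat, 2 ^ (- a%:Z) < e) ->
  (forall p j, Y p j != 0 -> (`|j| <= C p)%N) ->
  (forall p j, 2 ^ `|j|%:Z * `|Y p j| <= 2 ^ (C p)%:Z) ->
  (forall p n, E p n -> (4 * C p <= n)%N) ->
  (forall p q n m d, E q n -> E p m -> D d -> (q = p /\ n = m) \/
     ((2 * (C p + C q) + m < n + d) || (2 * (C p + C q) + n + d < m))%N) ->
  exists x : c0 K, forall p m, E p m -> `|iter m T x - Y p| <= 2 ^ (- (C p)%:Z).
Proof.
move=> arch Ysupp Ybd Ege Esep.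
(* Since 0 is in [D], [h i <= |i|], and the factor [2 ^ |i|] in the bound on [Y] absorbs
   [2 ^ h i]. *)
have bound q i (t : int) : `|2 ^ (h i - t) * Y q i| <= 2 ^ ((C q)%:Z - t).
  rewrite normrM gtr0_norm ?exprz_gt0// !expfzDr ?pnatr_eq0// mulrAC.
  rewrite ler_wpM2r ?exprz_ge0//; apply: le_trans (Ybd q i).
  rewrite ler_wpM2r// ler_exp2z//.
  by have := distN_le D0 i D0; rewrite addr0 /h; lia.
pose window j p n := E p n /\ (`|(j - n%:Z)%R| <= C p)%N.
have uniq_window j p n q m : window j p n -> window j q m -> p = q /\ n = m.
  move=> [En jn] [Em jm]; have [//|] := Esep _ _ _ _ _ En Em D0.
  by lia.
have /choice[x xP] : forall j, exists v : K,
    (forall p n, window j p n ->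
       v = 2 ^ (h (j - n%:Z) - h j) * Y p (j - n%:Z)) /\
    (v != 0 -> exists p n, window j p n).
  move=> j; have [[p [n jpn]]|none] := pselect (exists p n, window j p n).
    exists (2 ^ (h (j - n%:Z) - h j) * Y p (j - n%:Z)); split => [q m|_].
      by move=> /(uniq_window _ _ _ _ _ jpn)[<- <-].
    by exists p, n.
  exists 0; split => [p n jpn|/eqP//]; by case: none; exists p, n.
have xc0 : x \in @c0_pred K.
  apply: c0_predI => e e0; have [a ae] := arch e e0.
  (* As [n >= 4 * C p], the window of [n] lies in [j >= 3 * C p], where [h j >= j]; so
     [|x j| <= 2 ^ (C p - j) <= 2 ^ (- a)] once [j >= 2 * a]. *)
  exists (2 * a)%N => j ja; apply: le_lt_trans ae.
  have [->|/(xP j).2[p [n jpn]]] := eqVneq (x j) 0.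
    by rewrite normr0 exprz_ge0.
  rewrite ((xP j).1 _ _ jpn) (le_trans (bound _ _ _))// ler_exp2z//.
  have [/Ege Cn jn] := jpn.
  have : (`|j| <= distN D0 j)%N by apply: distN_ge => d _; lia.
  by rewrite /h; lia.
exists (C0 xc0) => p m Em; apply: c0_norm_le => j.
rewrite -[X in `|X|]/(iter m T (C0 xc0) j - Y p j) iter_exshift /=.
have [[q [n [En jn]]]|none] := pselect (exists q n, window (j + m%:Z) q n).
  rewrite ((xP _).1 q n)// mulrA -expfzDr ?pnatr_eq0//.
  set i := j + m%:Z - n%:Z.
  have -> : h (j + m%:Z) - h j + (h i - h (j + m%:Z)) = h i - h j by lia.
  (* For distinct windows, separation at [d = 0] puts [j] outside the support of [Y p]. *)
  have [[qp nm]|sep0] := Esep _ _ _ _ _ En Em D0.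
    have -> : i = j by rewrite /i nm addrK.
    by rewrite subrr expr0z mul1r qp subrr normr0 exprz_ge0.
  have -> : Y p j = 0.
    by apply: contrapT => /eqP /Ysupp; lia.
  rewrite subr0 (le_trans (bound _ _ _))// ler_exp2z//.
  suff : (C q + C p <= distN D0 j)%N by rewrite /h; lia.
  apply: distN_ge => d Dd.
  by have [[? ?]|] := Esep _ _ _ _ _ En Em Dd; lia.
have -> : x (j + m%:Z) = 0.
  by apply: contrapT => /eqP /(xP _).2.
have -> : Y p j = 0.
  apply: contrapT => /eqP /Ysupp jC; apply: none; exists p, m.
  by split => //; rewrite addrK.
by rewrite mulr0 subr0 normr0 exprz_ge0.
Qed.

End example.

(** * A dense sequence of finitely supported vectors *)

Section dense_sequence.
Context (K : numFieldType) (d : nat -> K).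
Hypothesis d_dense : forall x e, 0 < e -> exists n, `|x - d n| < e.

Lemma pickle_int_bounded N :
  exists L, forall j : int, (pickle j < N)%N -> (`|j| <= L)%N.
Proof.
elim: N => [|N [L HL]]; first by exists 0%N.
exists (maxn L `|odflt 0%R (unpickle N : option int)|) => j.
rewrite ltnS leq_eqVlt => /orP[/eqP <-|/HL jL]; first by rewrite pickleK leq_maxr.
by rewrite leq_max jL.
Qed.

Lemma bounded_pickle_int N :
  exists L, forall j : int, (`|j| < N)%N -> (pickle j < L)%N.
Proof.
elim: N => [|N [L HL]]; first by exists 0%N.
exists (L + pickle N%:Z + pickle (- N%:Z)).+1 => j; rewrite ltnS leq_eqVlt.
case/orP=> [/eqP jN|/HL jL]; last by lia.
have [->|->] : j = N%:Z \/ j = - N%:Z by lia.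
  by rewrite ltnS -addnA addnCA leq_addr.
by rewrite ltnS leq_addl.
Qed.

(* The second component of the code is a lower bound on the window size C p of
   code_size: it makes every vector of the dense family reappear with
   arbitrarily small error 2^-(C p). *)
Definition code (p : nat) : seq nat * nat :=
  odflt ([::], 0%N) (unpickle p).

(** Past the end of [s] the default 0 is read, so the support is finite. *)
Lemma finsupp_c0 (s : seq nat) :
  (fun j : int => [seq d a | a <- s]`_(pickle j)) \in @c0_pred K.
Proof.
apply: c0_predI => e e0; have [L HL] := pickle_int_bounded (size s).
exists L.+1 => j Lj; rewrite nth_default ?normr0// size_map leqNgt.
by apply/negP => /HL; lia.
Qed.

Definition finsupp (s : seq nat) : c0 K := C0 (finsupp_c0 s).

Lemma finsupp_supp s : exists L, forall j, finsupp s j != 0 -> (`|j| <= L)%N.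
Proof.
have [L HL] := pickle_int_bounded (size s); exists L => j.
have [/HL//|sj] := ltnP (pickle j) (size s).
by rewrite /= nth_default ?eqxx// size_map.
Qed.

Lemma finsupp_dense (z : c0 K) e : 0 < e -> exists s, `|finsupp s - z| <= e.
Proof.
move=> e0; have [N zN] := c0_small z e0.
have [L NL] := bounded_pickle_int N.
have /choice[a aP] := fun j : int => d_dense (z j) e0.
(* All [j] with [|j| < N] have a code below [L]; positions coding no integer get a default entry
   that is never read. *)
exists [seq a (odflt 0 (unpickle i)) | i <- iota 0 L].
apply: c0_norm_le => j; rewrite -[X in `|X|]/(_ - z j) /=.
have [jL|Lj] := ltnP (pickle j) L.
  rewrite -map_comp (nth_map 0%N) ?size_iota// nth_iota//= add0n pickleK /=.
  by rewrite distrC ltW.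
rewrite nth_default ?size_map ?size_iota// sub0r normrN ltW// zN//.
by rewrite leqNgt; apply/negP => /NL; rewrite ltnNge Lj.
Qed.

End dense_sequence.

(** * Assembly over a scalar field with a dense sequence *)

Section main.
Context (R : realType) (K : numFieldType) (d : nat -> K).
Hypothesis d_dense : forall x e, 0 < e -> exists n, `|x - d n| < e.
Hypothesis arch : forall e : K, 0 < e -> exists a : nat, 2 ^ (- a%:Z) < e.

Let Y p := finsupp d (code p).1.

Lemma code_size p : exists C : nat,
  [/\ forall j, Y p j != 0 -> (`|j| <= C)%N,
      forall j, 2 ^ `|j|%:Z * `|Y p j| <= 2 ^ C%:Z &
      ((code p).2 <= C)%N].
Proof.
have [L HL] := finsupp_supp d (code p).1.
have [a aY] : exists a : nat, `|Y p| <= 2 ^ a%:Z.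
  have [->|Y0] := eqVneq (Y p) 0; first by exists 0%N; rewrite normr0 exprz_ge0.
  have [|a] := arch (e := `|Y p|^-1); first by rewrite invr_gt0 normr_gt0.
  by rewrite -invr_expz ltf_pV2 ?posrE ?exprz_gt0 ?normr_gt0// => /ltW; exists a.
(* [L] bounds the support, [2 ^ a] the norm, and the last term secures the prescribed minimum. *)
exists (L + a + (code p).2)%N; split=> [j /HL|j|]; [lia| |lia].
have [->|/HL jL] := eqVneq (Y p j) 0.
  by rewrite normr0 mulr0 exprz_ge0.
apply: (@le_trans _ _ (2 ^ L%:Z * 2 ^ a%:Z)).
  apply: ler_pM; rewrite ?exprz_ge0//; first by rewrite ler_exp2z.
  exact: le_trans (c0_norm_ub _ _) aY.
by rewrite -expfzDr ?pnatr_eq0// ler_exp2z// ; lia.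
Qed.

Lemma exists_fhc_not_chaotic : exists (D : set nat) (D0 : D 0%N),
  frequently_hypercyclic R (wshift (exweight_le K D0)) /\
  ~ distributionally_chaotic R (wshift (exweight_le K D0)).
Proof.
have /choice[C CP] := code_size.
have D0 : sepD C 0%N by left.
exists (sepD C), D0; split; last exact: exshift_not_chaotic (sepD_density C).
have [x xP] : exists x : c0 K, forall p m, sepE C p m ->
    `|iter m (wshift (exweight_le K D0)) x - Y p| <= 2 ^ (- (C p)%:Z).
  apply: exshift_orbit arch _ _ _ _.
  - by move=> p j; have [+ _ _] := CP p; exact.
  - by move=> p j; have [_ + _] := CP p; exact.
  - exact: sepE_ge.
  - exact: sepE_sep.
exists x => U Uop [z Uz].
have /nbhs_normP[e /= e0 eU] : nbhs z U by exact: open_nbhs_nbhs.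
have e2 : 0 < e / 2 by rewrite divr_gt0.
have [s sz] := finsupp_dense d_dense z e2.
have [a ae] := arch e2.
pose p := pickle (s, a).
have codep : code p = (s, a) by rewrite /code /p pickleK.
apply: (lower_density_gt0 _ (sepE_density C p)) => m Em /=.
apply: eU => /=; rewrite distrC (splitr e).
have -> : iter m (wshift (exweight_le K D0)) x - z =
  (iter m (wshift (exweight_le K D0)) x - Y p) + (finsupp d s - z).
  by rewrite /Y codep addrA subrK.
rewrite (le_lt_trans (ler_normD _ _))// ltr_leD//.
rewrite (le_lt_trans (xP _ _ Em))// (le_lt_trans _ ae)// ler_exp2z//.
by have [_ _] := CP p; rewrite codep /=; lia.
Qed.

End main.

(** * Real and complex scalars *)

Lemma exp2N_arch (R : realType) (e : R) : 0 < e ->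
  exists a : nat, 2 ^ (- a%:Z) < e.
Proof.
move=> e0; exists (Num.truncn e^-1).+1.
rewrite -invr_expz invf_plt ?posrE ?exprz_gt0//.
apply: lt_trans (truncnS_gt _) _.
by rewrite -exprnP -natrX ltr_nat ltn_expl.
Qed.

Definition ratseq (R : realType) (n : nat) : R :=
  ratr (odflt 0 (unpickle n : option rat)).

Lemma ratseq_dense (R : realType) (x e : R) : 0 < e ->
  exists n, `|x - ratseq R n| < e.
Proof.
move=> e0; have /rat_in_itvoo[q] : x - e < x + e.
  by rewrite ltrBlDr -addrA ltrDl addr_gt0.
rewrite in_itv /= => qx; exists (pickle q).
by rewrite /ratseq pickleK /= ltr_distl; move: qx; rewrite ltrBlDr ltrBlDr; lra.
Qed.

Definition complex_ratseq (R : realType) (n : nat) : R[i] :=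
  let p : nat * nat := odflt (0%N, 0%N) (unpickle n) in
  (ratseq R p.1 +i* ratseq R p.2)%C.

(** The order of [R[i]] compares only numbers with equal imaginary parts; radii are thus real, and
    estimates over [R] carry over. *)
Lemma complex_gt0P (R : realType) (e : R[i]) : 0 < e ->
  exists2 r : R, 0 < r & e = r%:C%C.
Proof.
case: e => a b; rewrite ltcE /= => /andP[/eqP b0 a0]; exists a => //.
by rewrite b0.
Qed.

Lemma complex_ratseq_dense (R : realType) (z e : R[i]) : 0 < e ->
  exists n, `|z - complex_ratseq R n| < e.
Proof.
move=> /complex_gt0P[r r0 ->]; case: z => x y.
have r2 : 0 < r / 2 by rewrite divr_gt0.
have [[n xn] [m ym]] := (ratseq_dense x r2, ratseq_dense y r2).
exists (pickle (n, m)); rewrite /complex_ratseq pickleK /=.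
set u := x - _ in xn; set v := y - _ in ym.
rewrite -[X in `|X|]/((u +i* v)%C); move: u v xn ym => u v xn ym.
have -> : (u +i* v)%C = u%:C%C + 'i%C * v%:C%C by simpc.
have -> : r%:C%C = (r / 2)%:C%C + (r / 2)%:C%C by rewrite -rmorphD -splitr.
rewrite (le_lt_trans (ler_normD _ _))// ltrD//.
  by rewrite normc_def /= expr0n addr0 sqrtr_sqr ltcR.
have i1 : `|'i%C| = 1 :> R[i].
  by rewrite normc_def /= expr0n expr1n add0r sqrtr1.
by rewrite normrM i1 mul1r normc_def /= expr0n addr0 sqrtr_sqr ltcR.
Qed.

Theorem theorem7 (R : realType) :
  (exists w : int -> R,
    [/\ forall n, 0 < w n,
        exists M : R, forall n, w n <= M &
        exists B : {linear c0 R -> c0 R},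
          [/\ is_weighted_shift w B,
              frequently_hypercyclic R B &
              ~ distributionally_chaotic R B]]) /\
  (exists w : int -> R,
    [/\ forall n, 0 < w n,
        exists M : R, forall n, w n <= M &
        exists B : {linear c0 R[i] -> c0 R[i]},
          [/\ is_weighted_shift (fun n => real_complex R (w n)) B,
              frequently_hypercyclic R B &
              ~ distributionally_chaotic R B]]).
Proof.
have exw_le D (D0 : D 0%N) : exists M : R, forall n, exweight R D0 n <= M.
  by exists 2 => n; rewrite (le_trans (ler_norm _))// exweight_le.
split.
  have [D [D0 [fhc ndc]]] :=
    exists_fhc_not_chaotic R (@ratseq_dense R) (@exp2N_arch R).
  exists (exweight R D0); split => //; first exact: exweight_gt0.
  exists (wshift (exweight_le R D0)); split => //.
  exact: wshift_is_weighted_shift.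
have archC (e : R[i]) : 0 < e -> exists a : nat, 2 ^ (- a%:Z) < e.
  move=> /complex_gt0P[r /exp2N_arch[a ar] ->]; exists a.
  by move: ar; rewrite -ltcR fmorphXz rmorph_nat.
have [D [D0 [fhc ndc]]] :=
  exists_fhc_not_chaotic R (@complex_ratseq_dense R) archC.
exists (exweight R D0); split => //; first exact: exweight_gt0.
exists (wshift (exweight_le R[i] D0)); split => //.
(* The weights are powers of 2, which the embedding of [R] into [R[i]] preserves. *)
rewrite (_ : (fun n => _) = exweight R[i] D0).
  exact: wshift_is_weighted_shift.
by apply/funext => n; rewrite /exweight fmorphXz rmorph_nat.
Qed.
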